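(* The global proof size for the language Minimum Spanning Tree (MST) is in $O(n\log n)$. That is, there exists a purely global nondeterministic scheme for MST whose global certificate on $n$-node instances of the language has $O(n\log n)$ bits.
   Context: A network is a finite connected simple graph without loops; $n$ is its number of nodes. Nodes carry pairwise distinct identifiers, which are positive integers in a range polynomial in $n$ (at most $n^{\kappa}$ for a fixed constant $\kappa\ge 1$), so each identifier has $O(\log n)$ bits. Nodes and edges may carry inputs. A distributed language is a set of graphs with inputs (membership does not depend on identifiers). A purely global nondeterministic scheme for a language $\mathcal L$ consists of a verifier of constant radius $r$: each node $v$ sees its $r$-neighborhood (the structure of the graph, the identifiers and the inputs of nodes and edges, within distance $r$ of $v$), together with one single certificate string that is seen by all nodes, and outputs accept or reject. The verifier is uniform (it does not know $n$). The scheme is correct if for every labeled graph: there exists a certificate making every node accept if and only if the labeled graph is in $\mathcal L$. The global proof size $s_g(n)$ is the number of bits of the certificate used on $n$-node graphs of $\mathcal L$. MST: inputs are an edge-weighted graph, in which all weights are distinct positive integers polynomial in $n$ (so each is written on $O(\log n)$ bits), and a set of selected edges (each edge is marked selected or not). The labeled graph is in MST if and only if the selected edges form a minimum spanning tree of the weighted graph. *)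

(* Defs.v *)
From mathcomp Require Import all_boot.
From mathcomp Require Import finmap.

Set Implicit Arguments.
Unset Strict Implicit.
Unset Printing Implicit Defensive.

(** * Networks and labeled graphs *)

Record network := Network {
  node :> finType;
  adj : rel node;
  adj_sym : symmetric adj;
  adj_irr : irreflexive adj;
  node_gt0 : 0 < #|node|;
  adj_connected : forall u v : node, connect adj u v
}.

(** The edge [uv] is the two-element set [[set u; v]]. *)
Definition edges (G : network) : {set {set G}} :=
  [set e | [exists u : G, exists v : G, adj u v && (e == [set u; v])]].

(** [einput] is total for convenience; its values outside [edges net] carry no
    meaning and are read neither by the verifiers nor by the language below. *)
Record lgraph (A B : choiceType) := LGraph {
  net :> network;
  ninput : net -> A;
  einput : {set net} -> B
}.

(** The identifier assignment is not part of [lgraph], so that membership in a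
    language cannot depend on it. *)
Definition language (A B : choiceType) := lgraph A B -> Prop.

Definition valid_ids (kappa : nat) (G : network) (id : G -> nat) : Prop :=
  injective id /\ forall v, 0 < id v <= #|G| ^ kappa.

(** * Local views *)

(** Nodes at distance at most [r] from [v]. *)
Definition ball (G : network) (r : nat) (v : G) : {set G} :=
  iter r (fun S => S :|: [set u | [exists w in S, adj w u]]) [set v].

(** Since identifiers are pairwise distinct, a neighborhood is represented, with
    no loss or gain of information, by finite sets mentioning nodes only through
    their identifiers; every edge occurs in both orientations. *)
Record view (A B : choiceType) := View {
  view_center : nat;
  view_nodes : {fset nat * A};
  view_edges : {fset nat * nat * B}
}.

Definition local_view (A B : choiceType) (r : nat) (G : lgraph A B)
    (id : G -> nat) (v : G) : view A B :=
  View (id v)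
    [fset (id u, ninput u) | u in ball r v]%fset
    [fset (id p.1, id p.2, einput [set p.1; p.2]) | p in
       [set p : G * G | [&& p.1 \in ball r v, p.2 \in ball r v & adj p.1 p.2]]]%fset.

(** * Purely global nondeterministic schemes *)

Definition verifier (A B : choiceType) := view A B -> seq bool -> bool.

Definition all_accept (A B : choiceType) (r : nat) (V : verifier A B)
    (G : lgraph A B) (id : G -> nat) (c : seq bool) : Prop :=
  forall v : G, V (local_view r id v) c.

(** [inst] is the class of admissible inputs, on which alone the scheme is
    required to be correct. *)
Definition correct_scheme (A B : choiceType) (kappa : nat)
    (inst L : language A B) (r : nat) (V : verifier A B) : Prop :=
  forall (G : lgraph A B) (id : G -> nat), inst G -> valid_ids kappa id ->
    (exists c, all_accept r V id c) <-> L G.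

Definition scheme_size (A B : choiceType) (kappa : nat)
    (inst L : language A B) (r : nat) (V : verifier A B) (s : nat -> nat) : Prop :=
  forall (G : lgraph A B) (id : G -> nat), inst G -> valid_ids kappa id ->
    L G -> exists2 c, all_accept r V id c & size c <= s #|G|.

Definition bigO (s f : nat -> nat) : Prop :=
  exists C N : nat, forall n, N <= n -> s n <= C * f n.

Definition global_proof_size_in_O (A B : choiceType) (kappa : nat)
    (inst L : language A B) (f : nat -> nat) : Prop :=
  exists (r : nat) (V : verifier A B) (s : nat -> nat),
    [/\ correct_scheme kappa inst L r V, scheme_size kappa inst L r V s
      & bigO s f].

(** * Minimum spanning trees *)

Definition edge_rel (G : network) (T : {set {set G}}) : rel G :=
  fun u v => [set u; v] \in T.

Definition spanning_tree (G : network) (T : {set {set G}}) : Prop :=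
  [/\ T \subset edges G,
      forall u v : G, connect (edge_rel T) u v
    & forall p : seq G, 2 < size p -> ~ ucycle (edge_rel T) p].

Definition mst_graph := lgraph unit (nat * bool)%type.

Definition weight (G : mst_graph) (e : {set G}) : nat := (einput e).1.

Definition selected (G : mst_graph) : {set {set G}} :=
  [set e in edges G | (einput e).2].

Definition mst_instance (c : nat) (G : mst_graph) : Prop :=
  {in edges G &, injective (@weight G)} /\
  {in edges G, forall e, 0 < weight e <= #|G| ^ c}.

Definition MST (G : mst_graph) : Prop :=
  spanning_tree (selected G) /\
  forall T : {set {set G}}, spanning_tree T ->
    \sum_(e in selected G) weight e <= \sum_(e in T) weight e.

(** [trunc_log 2 n] is the integer part of the base-2 logarithm, which does not
    change the class O(n log n). *)
Definition nlogn (n : nat) : nat := n * trunc_log 2 n.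

(* Main.v *)
Require Import Defs.
From mathcomp Require Import all_boot.
From mathcomp Require Import finmap zify.

(** A set T of edges is the minimum spanning tree iff, for every edge uv, T
    contains uv exactly when u and v are not joined by edges of T lighter than
    uv. This condition determines T (by induction on the weight), implies that T
    is a spanning tree, and holds for any spanning tree that no edge swap
    improves. The certificate lists the identifiers and weights of the edges of
    T, with O(log n) bits for each: every node compares the list with its
    incident edges and tests the condition on them. Since the list is exact
    around each node, spurious entries lie in other components and are
    harmless. *)

Set Implicit Arguments.
Unset Strict Implicit.
Unset Printing Implicit Defensive.

(** * Spanning trees *)

Section SpanningTrees.

Variable G : network.
Implicit Types (T : {set {set G}}) (p : seq G).

Lemma mem_edges (u v : G) : ([set u; v] \in edges G) = adj u v.
Proof.
rewrite inE; apply/existsP/idP => [[a /existsP [b /andP [ab /eqP E]]]|uv].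
  have : (a \in [set u; v]) && (b \in [set u; v]) by rewrite E !inE !eqxx orbT.
  rewrite !inE => /andP [/orP [] /eqP Ea /orP [] /eqP Eb]; subst a b => //.
  - by rewrite adj_irr in ab.
  - by rewrite adj_sym.
  - by rewrite adj_irr in ab.
by exists u; apply/existsP; exists v; rewrite uv eqxx.
Qed.

Lemma edgesP (e : {set G}) :
  reflect (exists u v, adj u v /\ e = [set u; v]) (e \in edges G).
Proof.
apply: (iffP idP) => [|[u [v [uv ->]]]]; last by rewrite mem_edges.
rewrite inE => /existsP [u /existsP [v /andP [uv /eqP ->]]].
by exists u, v.
Qed.

Lemma eq_pair_set (u v x y : G) :
  [set u; v] = [set x; y] -> u = x /\ v = y \/ u = y /\ v = x.
Proof.
move=> E.
have /set2P Hu : u \in [set x; y] by rewrite -E set21.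
have /set2P Hv : v \in [set x; y] by rewrite -E set22.
have /set2P Hx : x \in [set u; v] by rewrite E set21.
have /set2P Hy : y \in [set u; v] by rewrite E set22.
by case: Hu Hv Hx Hy => [] ? [] ? [] ? [] ?; subst; auto.
Qed.

Lemma edge_rel_sym T : symmetric (edge_rel T).
Proof. by move=> u v; rewrite /edge_rel setUC. Qed.

Lemma connect_edge_sym T : connect_sym (edge_rel T).
Proof. by apply: sym_connect_sym; apply: edge_rel_sym. Qed.

Lemma sub_connect T T' : T \subset T' ->
  subrel (connect (edge_rel T)) (connect (edge_rel T')).
Proof.
move=> /subsetP s; apply: connect_sub => x y xy.
by apply: connect1; apply: s.
Qed.

Lemma path_setD1 T (a b x : G) p :
  b \notin x :: p -> path (edge_rel T) x p ->
  path (edge_rel (T :\ [set a; b])) x p.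
Proof.
elim: p x => //= y p IHp x; rewrite !inE !negb_or => /and3P [bx by_ bp].
case/andP=> xy yp; rewrite IHp ?inE ?negb_or ?by_ // andbT.
rewrite /edge_rel !inE [_ \in T]xy andbT; apply/eqP => /setP /(_ b).
by rewrite !inE eqxx orbT (negbTE bx) (negbTE by_).
Qed.

(** The rest of the cycle leads back from [next p x] to [x] without using the removed edge. *)
Lemma connect_next T p x : ucycle (edge_rel T) p -> 2 < size p -> x \in p ->
  connect (edge_rel (T :\ [set x; next p x])) x (next p x).
Proof.
case/andP=> cp up sp xp; case: (rot_to xp) => i s Ep.
have us : uniq (x :: s) by rewrite -Ep rot_uniq.
have cs : cycle (edge_rel T) (x :: s) by rewrite -Ep rot_cycle.
have ss : 2 < size (x :: s) by rewrite -Ep size_rot.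
rewrite -(next_rot i up) Ep {p up cp sp xp i Ep}.
case: s us cs ss => [|y [|z s]] //= /and3P [xs ys _] /and3P [_ yz zs] _.
rewrite eqxx connect_edge_sym.
move: xs ys; rewrite !inE !negb_or => /and3P [xy xz xs] /andP [yz' ys].
(* The edge [yz] misses [x], and the path from [z] back to [x] misses [y], so neither uses the edge
   [xy]. *)
apply: (@connect_trans _ _ z).
  apply: connect1; rewrite /edge_rel !inE [_ \in T]yz andbT.
  apply/eqP => /setP /(_ x).
  by rewrite !inE eqxx (negbTE xy) (negbTE xz).
apply/connectP; exists (rcons s x); last by rewrite last_rcons.
by apply: path_setD1 => //; rewrite inE mem_rcons inE !negb_or yz' eq_sym xy ys.
Qed.

(** A simple path from [u] to [v] avoiding the edge has at least three nodes, so the edge closes it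
    into a forbidden cycle. *)
Lemma acyclic_bridge T (u v : G) :
  (forall p, 2 < size p -> ~ ucycle (edge_rel T) p) ->
  adj u v -> [set u; v] \in T ->
  ~~ connect (edge_rel (T :\ [set u; v])) u v.
Proof.
move=> acy uv uvT; apply/negP => /connectP [p0 p0P Ev].
move: Ev; case/shortenP: p0P => p pP up _ Ev.
have uv' : u != v by apply/eqP => E; rewrite E adj_irr in uv.
apply: (acy (u :: p)).
  case: p pP Ev {up} => [|x [|y p]] //=; first by move=> _ E; rewrite E eqxx in uv'.
  by rewrite /edge_rel !inE => + E; rewrite E eqxx.
rewrite /ucycle up andbT /= rcons_path -Ev edge_rel_sym [edge_rel T u v]uvT andbT.
by apply: sub_path pP => x y; rewrite /edge_rel inE => /andP [].
Qed.

Lemma path_split (e e' : rel G) u p : path e u p -> ~~ path e' u p ->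
  exists p1 b p2, p = p1 ++ b :: p2 /\ ~~ e' (last u p1) b.
Proof.
elim: p u => //= x p IHp u /andP [_ xp].
case: (boolP (e' u x)) => /= [_ nxp|ux _]; last by exists [::], x, p.
by have [p1 [b [p2 [-> H]]]] := IHp _ xp nxp; exists (x :: p1), b, p2.
Qed.

(** * Kruskal's condition and minimum spanning trees *)

Variable w : {set G} -> nat.
Hypothesis w_inj : {in edges G &, injective w}.

Definition lighter T (m : nat) : {set {set G}} := [set f in T | w f < m].

(** The acceptance rule of Kruskal's algorithm, stated about [T] itself and edge by edge, so that
    each node can test its incident edges. *)
Definition kruskal T : bool :=
  [forall u : G, forall v : G, adj u v ==>
    (([set u; v] \in T) ==
     ~~ connect (edge_rel (lighter T (w [set u; v]))) u v)].

Lemma kruskalP T : reflect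
  (forall u v, adj u v -> ([set u; v] \in T) =
     ~~ connect (edge_rel (lighter T (w [set u; v]))) u v)
  (kruskal T).
Proof.
apply: (iffP forallP) => [H u v uv|H u].
  by have /forallP /(_ v) := H u; rewrite uv => /eqP.
by apply/forallP => v; apply/implyP => uv; rewrite -H.
Qed.

(** Whether an edge belongs to the set depends only on the lighter edges of the set, which agree by
    induction. *)
Lemma kruskal_unique T T' : T \subset edges G -> T' \subset edges G ->
  kruskal T -> kruskal T' -> T = T'.
Proof.
move=> /subsetP sT /subsetP sT' /kruskalP kT /kruskalP kT'.
suff H m e : w e < m -> (e \in T) = (e \in T').
  by apply/setP => e; apply: (H (w e).+1).
elim: m e => // m IHm e; rewrite ltnS => em.
case: (boolP (e \in edges G)) => [/edgesP [u [v [uv Ee]]]|ne]; last first.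
  by apply/idP/idP => [/sT|/sT']; rewrite (negbTE ne).
rewrite Ee kT // kT' // -Ee; congr (~~ connect (edge_rel _) u v).
apply/setP => f; rewrite !inE.
case: ltnP => fe; last by rewrite !andbF.
by rewrite !andbT; apply: IHm; apply: leq_trans em.
Qed.

Lemma kruskal_spanning_tree T : T \subset edges G -> kruskal T ->
  spanning_tree T.
Proof.
move=> sT /kruskalP kT; split=> //.
  move=> u v; apply: connect_sub (adj_connected u v) => x y xy.
  case: (boolP ([set x; y] \in T)) => [xyT|]; first exact: connect1.
  rewrite kT // negbK; apply: sub_connect.
  by apply/subsetP => f; rewrite inE => /andP [].
move=> p sp /andP [cp up].
have [x0 x0p] : exists x0, x0 \in p.
  by case: p sp {cp up} => // x p _; exists x; rewrite mem_head.
pose step x := [set x; next p x].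
have stepT x : x \in p -> step x \in T by move=> xp; apply: (next_cycle cp).
case: (arg_maxnP (w \o step) x0p) => x xp xmax.
(* Around the cycle, the heaviest edge [step x] is bypassed by edges of [C] that are strictly
   lighter, which contradicts its membership in [T]. *)
pose C := [set step y | y in p].
have cC : ucycle (edge_rel C) p.
  rewrite /ucycle up andbT; apply: cycle_from_next => // y yp.
  by apply: imset_f.
have := connect_next cC sp xp.
suff /sub_connect s : C :\ step x \subset lighter T (w (step x)).
  have xT : step x \in T by apply: stepT.
  have xadj : adj x (next p x) by rewrite -mem_edges (subsetP sT).
  by move: xT => /[dup] xT; rewrite {1}/step kT // => /negP nc /s.
apply/subsetP => f; rewrite !inE => /andP [nf /imsetP [y yp Ef]]; subst f.
rewrite stepT // ltn_neqAle (xmax y yp : _ <= _) andbT; apply: contra nf => /eqP E.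
by apply/eqP/w_inj => //; apply: (subsetP sT); apply: stepT.
Qed.

Lemma spanning_tree_swap T (u v a b : G) :
    spanning_tree T -> adj u v -> [set u; v] \notin T -> [set a; b] \in T ->
    connect (edge_rel (T :\ [set a; b])) u a ->
    connect (edge_rel (T :\ [set a; b])) b v ->
  spanning_tree ([set u; v] |: T :\ [set a; b]).
Proof.
move=> [sT cT aT] uv uvT abT ua bv.
set T0 := T :\ _ in ua bv *; set T' := _ |: _.
have s0 : T0 \subset T' by apply: subsetUr.
have adj_ab : adj a b by rewrite -mem_edges (subsetP sT).
have T'uv : edge_rel T' u v by rewrite /edge_rel !inE eqxx.
have ab : connect (edge_rel T') a b.
  apply: (@connect_trans _ _ u).
    by rewrite connect_edge_sym; apply: sub_connect ua.
  apply: connect_trans (connect1 T'uv) _.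
  by rewrite connect_edge_sym; apply: sub_connect bv.
split.
- by rewrite subUset sub1set mem_edges uv (subset_trans _ sT) ?subsetDl.
- move=> x y; apply: connect_sub (cT x y) => {x y} x y xy.
  case: (altP ([set x; y] =P [set a; b])) => [|ne].
    case/eq_pair_set => [[-> ->]|[-> ->]] //.
    by rewrite connect_edge_sym.
  by apply: connect1; rewrite /edge_rel !inE ne [_ \in T]xy orbT.
move=> p sp cp; case/andP: (cp) => cp' up.
(* A cycle within [T] is excluded. Any other cycle uses [uv], so its remainder joins [u] to [v] in
   [T0]; then [a] and [b] are joined there too, although [ab] is a bridge of [T]. *)
case: (boolP (all (fun x => edge_rel T x (next p x)) p)) => [/allP H|].
  by apply: (aT p sp); rewrite /ucycle up andbT; apply: cycle_from_next.
case/allPn => x xp nx; have := connect_next cp sp xp.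
have Euv : [set x; next p x] = [set u; v].
  have := next_cycle cp' xp; rewrite /edge_rel in nx *.
  by rewrite !inE (negbTE nx) andbF orbF => /eqP.
rewrite Euv.
have -> : T' :\ [set u; v] = T0.
  by rewrite setU1K // !inE (negbTE uvT) andbF.
move=> c; have {c} c : connect (edge_rel T0) u v.
  by case: (eq_pair_set Euv) c => [[-> ->]|[-> ->]] //; rewrite connect_edge_sym.
apply/negP: (acyclic_bridge aT adj_ab abT); rewrite negbK -/T0.
rewrite connect_edge_sym; apply: connect_trans bv _.
rewrite connect_edge_sym in c; exact: connect_trans c ua.
Qed.

(** An edge of [T] is a bridge, so the condition can fail only at some [e] outside [T]. The tree
    path between the ends of [e] then has an edge not lighter than [e]; exchanging it for [e] is a
    strict gain since weights are distinct. *)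
Lemma kruskal_or_improve T : spanning_tree T ->
  kruskal T \/ exists2 T', spanning_tree T' &
    \sum_(e in T') w e < \sum_(e in T) w e.
Proof.
move=> stT; have [sT cT aT] := stT.
case: (boolP (kruskal T)) => [|nk]; first by left.
right; move: nk; rewrite negb_forall => /existsP [u].
rewrite negb_forall => /existsP [v]; rewrite negb_imply => /andP [uv].
set e := [set u; v].
have [eT|eT] := boolP (e \in T).
  rewrite eq_sym eqb_id negbK => c; case/negP: (acyclic_bridge aT uv eT).
  apply: sub_connect c; apply/subsetP => f; rewrite !inE => /andP [-> fe].
  by rewrite andbT; apply: contraTneq fe => ->; rewrite ltnn.
rewrite eq_sym eqbF_neg negbK => nc.
have /connectP [p0 p0P Ev] := cT u v.
move: Ev; case/shortenP: p0P => p pP up _ Ev.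
have [|p1 [b [p2 [Ep]]]] := path_split (e' := edge_rel (lighter T (w e))) pP.
  by apply: contra nc => pl; apply/connectP; exists p.
set a := last u p1 => nab.
move: pP up Ev; rewrite Ep cat_path last_cat -cat_cons cat_uniq /= -/a.
case/and3P=> up1 ab bp2 /and3P [_ /norP [bp1 np] _] Ev.
have ap2 : a \notin b :: p2.
  rewrite inE negb_or; apply/andP; split.
    by apply: contraNneq bp1 => <-; rewrite mem_last.
  by apply: contra np => ap; apply/hasP; exists a => //; apply: mem_last.
have abT : [set a; b] \in T by [].
exists (e |: T :\ [set a; b]).
  apply: spanning_tree_swap => //.
    by apply/connectP; exists p1 => //; apply: path_setD1.
  by apply/connectP; exists p2 => //; rewrite setUC; apply: path_setD1.
rewrite big_setU1 ?inE ?(negbTE eT) ?andbF //= [X in _ < X](big_setD1 _ abT) /=.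
rewrite ltn_add2r ltn_neqAle; move: nab; rewrite /edge_rel inE abT /= -leqNgt => ->.
rewrite andbT; apply: contra eT => /eqP/w_inj ->//; first by rewrite mem_edges.
exact: (subsetP sT).
Qed.

Lemma kruskal_minimum T : T \subset edges G ->
  kruskal T <-> spanning_tree T /\
    forall T', spanning_tree T' -> \sum_(e in T) w e <= \sum_(e in T') w e.
Proof.
move=> sT; split=> [kT|[stT minT]]; last first.
  case: (kruskal_or_improve stT) => // [[T' /minT]].
  by rewrite leqNgt => /negbTE ->.
split=> [|T']; first exact: kruskal_spanning_tree.
(* Strict improvements of [T'] must end at a tree with Kruskal's condition, which is [T] by
   uniqueness. *)
have [m] := ubnP (\sum_(e in T') w e); elim: m T' => // m IHm T' T'm stT'.
have [sT' _ _] := stT'.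
case: (kruskal_or_improve stT') => [kT'|[T'' stT'' lt]].
  by rewrite (kruskal_unique sT sT' kT kT').
apply: leq_trans (ltnW lt); apply: IHm => //.
exact: leq_trans lt _.
Qed.

End SpanningTrees.

(** * Components of a list of edges *)

Section Labels.

Variable T : eqType.
Implicit Types (l : seq (T * T)) (x y : T).

(* Two points get the same label iff [l] connects them: adding an edge relabels
   the component of one endpoint by the label of the other. *)
Fixpoint label l x : T :=
  if l is (a, b) :: l' then
    if label l' x == label l' a then label l' b else label l' x
  else x.

Lemma label_edge l a b : (a, b) \in l -> label l a = label l b.
Proof.
elim: l => //= -[c d] l IHl; rewrite inE => /orP [/eqP [-> ->]|/IHl -> //].
by rewrite eqxx; case: eqP.
Qed.

(** Labels stay within components. Taking reachability from a fixed point for [f] turns equal labels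
    into connectivity. *)
Lemma label_inv (U : Type) (f : T -> U) l :
  (forall a b, (a, b) \in l -> f a = f b) -> forall x, f (label l x) = f x.
Proof.
elim: l => //= -[a b] l IHl H x.
have fl y : f (label l y) = f y.
  by apply: IHl => c d cd; apply: H; rewrite inE cd orbT.
case: eqP => // /(congr1 f); rewrite !fl => ->.
by apply/esym/H; rewrite mem_head.
Qed.

End Labels.

(** Edges are inserted from the tail to the head, each joining two components of the edges behind
    it. *)
Fixpoint forest (T : eqType) (l : seq (T * T)) : bool :=
  if l is (a, b) :: l' then (label l' a != label l' b) && forest l' else true.

(** Each insertion makes the label of one endpoint disappear, and at least one label remains at the
    end. *)
Lemma forest_size (T : finType) (l : seq (T * T)) :
  0 < #|T| -> forest l -> size l < #|T|.
Proof.
move=> T0 fl; suff H : size l + #|[set label l x | x : T]| <= #|T|.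
  apply: leq_trans H; rewrite -addn1 leq_add2l card_gt0.
  by case/card_gt0P: T0 => x _; apply/set0Pn; exists (label l x); apply: imset_f.
elim: l fl => [|[a b] l IHl] /=; first by rewrite max_card.
case/andP=> nab /IHl; rewrite (cardsD1 (label l a)) imset_f // add1n addnS addSn.
apply: leq_trans; rewrite ltnS leq_add2l; apply/subset_leq_card/subsetP => y.
case/imsetP => x _ ->; rewrite !inE.
by case: ifP => [_|/negbT ->]; rewrite ?(eq_sym (label l b)) ?nab imset_f.
Qed.

(** * Binary encoding *)

(* A number is a sequence of blocks [true; digit], least significant digit
   first, closed by [false]. *)
Fixpoint decode (c : seq bool) : seq nat :=
  match c with
  | true :: b :: c' => if decode c' is m :: s then (b + m.*2) :: s else [::]
  | false :: c' => 0 :: decode c'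
  | _ => [::]
  end.

(** Padding to [k] digits costs two bits per digit and one closing bit. *)
Lemma decode_number k m : m < 2 ^ k ->
  exists2 e, size e <= k.*2.+1 & forall c, decode (e ++ c) = m :: decode c.
Proof.
elim: k m => [|k IHk] m; first by case: m => // _; exists [:: false].
rewrite expnS mul2n => mk; have [|e se de] := IHk m./2.
  by rewrite -ltn_double (leq_ltn_trans _ mk) // -[leqRHS]odd_double_half leq_addl.
exists [:: true, odd m & e]; first by rewrite doubleS.
by move=> c; rewrite /= de odd_double_half.
Qed.

Fixpoint triples (s : seq nat) : seq (nat * nat * nat) :=
  if s is [:: a, b, w & s'] then (a, b, w) :: triples s' else [::].

Lemma decode_triples k (l : seq (nat * nat * nat)) :
    {in l, forall t, [/\ t.1.1 < 2 ^ k, t.1.2 < 2 ^ k & t.2 < 2 ^ k]} ->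
  exists2 c, triples (decode c) = l & size c <= size l * (3 * k.*2.+1).
Proof.
elim: l => [|[[a b] w] l IHl] H; first by exists [::].
have [c cl sc] := IHl (fun t tl => H t (mem_behead (s := _ :: l) tl)).
have [/= ak bk wk] := H _ (mem_head _ _).
have [ea sa da] := decode_number ak.
have [eb sb db] := decode_number bk.
have [ew sw dw] := decode_number wk.
exists (ea ++ eb ++ ew ++ c); first by rewrite da db dw /= cl.
by rewrite !size_cat /=; lia.
Qed.

(** * The scheme *)

(** With both orientations present, a node finds all entries about itself by their first
    identifier. *)
Definition symmetrize (l : seq (nat * nat * nat)) : seq (nat * nat * nat) :=
  l ++ [seq (t.1.2, t.1.1, t.2) | t <- l].

Definition below (l : seq (nat * nat * nat)) (w : nat) : seq (nat * nat) :=
  [seq t.1 | t <- l & t.2 < w].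

(** The first pass compares the mark of each incident edge with the list and with Kruskal's
    condition; the second rejects listed edges at the center that are not selected edges there. *)
Definition mst_verifier : verifier unit (nat * bool)%type := fun vw c =>
  let l := symmetrize (triples (decode c)) in
  all (fun e => (e.1.1 == view_center vw) ==>
         ((e.2.2 == ((e.1, e.2.1) \in l)) &&
          (e.2.2 == (label (below l e.2.1) e.1.1 != label (below l e.2.1) e.1.2))))
      (view_edges vw) &&
  all (fun t => (t.1.1 == view_center vw) ==>
         ((t.1, (t.2, true)) \in view_edges vw)) l.

Lemma symmetrizeC l a b w :
  ((a, b, w) \in symmetrize l) = ((b, a, w) \in symmetrize l).
Proof.
suff H x y : (x, y, w) \in symmetrize l -> (y, x, w) \in symmetrize l.
  by apply/idP/idP; apply: H.
rewrite !mem_cat => /orP [xy|/mapP [[[y' x'] w'] xy [-> -> ->]]].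
  by apply/orP; right; apply/mapP; exists (x, y, w).
by rewrite xy.
Qed.

(** * Correctness of the verifier and existence of a short list *)

Section Scheme.

Variables (G : mst_graph) (id : G -> nat).
Hypothesis id_inj : injective id.

Lemma view_edges_center (v : G) a b i :
  ((a, b, i) \in view_edges (local_view 1 id v)) && (a == id v) <->
  exists u, [/\ adj v u, a = id v, b = id u & i = einput [set v; u]].
Proof.
split=> [/andP [/imfsetP /= [[x y]]]|[u [vu -> -> ->]]].
  rewrite inE /= => /and3P [_ _ xy] [-> -> ->] /eqP/id_inj Ex.
  by rewrite Ex in xy *; exists y.
rewrite eqxx andbT; apply/imfsetP; exists (v, u) => //=.
rewrite inE /= vu andbT !inE eqxx /=.
by apply/orP; right; apply/existsP; exists v; rewrite inE eqxx.
Qed.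

(* [l] lists the selected edges of [G], possibly with edges between identifiers
   that no node of [G] carries. *)
Definition lists_selected (l : seq (nat * nat * nat)) : Prop :=
  forall (u : G) b m, (id u, b, m) \in symmetrize l <->
    exists v, [/\ adj u v, b = id v & einput [set u; v] = (m, true)].

Lemma label_below l : lists_selected l -> forall (u v : G) m,
  (label (below (symmetrize l) m) (id u) ==
     label (below (symmetrize l) m) (id v)) =
  connect (edge_rel (lighter (@weight G) (selected G) m)) u v.
Proof.
move=> Hl u v m; set b := below _ _; set e := edge_rel _.
have bP x y : (x, y) \in b -> exists2 k, (x, y, k) \in symmetrize l & k < m.
  case/mapP=> [[p k]]; rewrite mem_filter /= => /andP [km kl] Exy; subst p.
  by exists k.
apply/eqP/idP => [E|].
  (* The identifiers of nodes reachable from [u] are closed under the list, as it is exact around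
     every node; entries between foreign identifiers never meet them. *)
  pose f a := [exists x, (id x == a) && connect e u x].
  have fS x y : (x, y) \in b -> f x -> f y.
    move=> /bP [k xyl km] /existsP [x' /andP [/eqP Ex ux]]; subst x.
    have [y' [x'y' -> E']] := (Hl x' y k).1 xyl.
    apply/existsP; exists y'; rewrite eqxx /=; apply: connect_trans ux _.
    apply: connect1; rewrite /e /edge_rel inE /weight E' km andbT.
    by rewrite inE mem_edges x'y' E'.
  have fE x y : (x, y) \in b -> f x = f y.
    move=> xy; apply/idP/idP; apply: fS => //.
    case: (bP _ _ xy) => k kl km; apply/mapP; exists (y, x, k) => //.
    by rewrite mem_filter km symmetrizeC.
  have : f (id v).
    rewrite -(label_inv fE) -E (label_inv fE); apply/existsP.
    by exists u; rewrite eqxx connect0.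
  by case/existsP => v' /andP [/eqP/id_inj ->].
case/connectP => p; elim: p u => [|x p IHp] u /=; first by move=> _ ->.
case/andP=> ux xp /(IHp x xp) <-; apply: label_edge.
move: ux; rewrite /e /edge_rel inE => /andP [].
rewrite inE mem_edges => /andP [ux sx] wx.
apply/mapP; exists (id u, id x, weight [set u; x]) => //.
rewrite mem_filter wx /=; apply/Hl; exists x; split=> //.
by rewrite /weight; move: sx; case: (einput _) => k [].
Qed.

Lemma mst_verifierP c :
  all_accept 1 mst_verifier id c <->
  lists_selected (triples (decode c)) /\ kruskal (@weight G) (selected G).
Proof.
set l := triples _; split=> [H|[Hl /kruskalP kG] v]; last first.
  rewrite /mst_verifier -/l; apply/andP; split; apply/allP.
    move=> [[a b] i] ei /=; apply/implyP => av.
    have [u [vu -> -> ->]] := (view_edges_center v a b i).1 ltac:(by rewrite ei av).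
    have E : (einput [set v; u]).2 = ([set v; u] \in selected G).
      by rewrite inE mem_edges vu.
    rewrite label_below //= E -kG // -/(weight _) eqxx andbT -E; apply/eqP.
    apply/idP/idP => [s|/Hl [u' [_ /id_inj <-]]]; last by move=> ->.
    apply/Hl; exists u; split=> //; rewrite /weight.
    by move: s; case: (einput [set v; u]) => k [].
  move=> [[a b] k] al /=; apply/implyP => /eqP Ea; subst a.
  have [u [vu Eb E]] := (Hl _ _ _).1 al.
  suff /view_edges_center /andP [] : exists u,
    [/\ adj v u, id v = id v, b = id u & (k, true) = einput [set v; u]] by [].
  by exists u.
have Hl : lists_selected l.
  move=> u b m; have /andP [/allP H1 /allP H2] := H u; split=> [bl|[v [uv -> E]]].
    have /= := H2 _ bl; rewrite eqxx /= => be.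
    have [|v [uv _ Eb E]] := (view_edges_center u (id u) b (m, true)).1.
      by rewrite be eqxx.
    by exists v.
  have /andP [/H1] := (view_edges_center u (id u) (id v) (m, true)).2
     (ex_intro _ v (And4 uv erefl erefl (esym E))).
  by rewrite /= eqxx /= => /andP [/eqP <-].
split=> //; apply/kruskalP => u v uv.
have /andP [/allP H1 _] := H u.
have /andP [/H1] := (view_edges_center u (id u) (id v) _).2
     (ex_intro _ v (And4 uv erefl erefl erefl)).
rewrite /= eqxx label_below //= => /andP [_ /eqP <-] _.
by rewrite inE mem_edges uv.
Qed.

Hypothesis w_inj : {in edges G &, injective (@weight G)}.

Lemma MST_kruskal : MST G <-> kruskal (@weight G) (selected G).
Proof.
apply: iff_sym; apply: kruskal_minimum => //.
by apply/subsetP => f; rewrite inE => /andP [].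
Qed.

(** With edges sorted by decreasing weight, those behind an edge are lighter, so Kruskal's condition
    keeps its ends apart there. The list is thus a forest, with fewer entries than nodes. *)
Lemma selected_list : kruskal (@weight G) (selected G) ->
  exists l, [/\ lists_selected l, size l < #|G| &
    {in l, forall t, exists u v, adj u v /\ t = (id u, id v, weight [set u; v])}].
Proof.
move=> /kruskalP kG.
pose wt (p : G * G) := weight [set p.1; p.2].
pose heavier p q := wt q <= wt p.
(* Comparing identifiers selects one orientation of each edge. *)
pose P := [pred p : G * G | ([set p.1; p.2] \in selected G) && (id p.1 < id p.2)].
pose s := sort heavier (enum P).
have sP p : (p \in s) = P p by rewrite mem_sort mem_enum.
have PS p : P p -> adj p.1 p.2.
  by case/andP; rewrite inE mem_edges => /andP [].
have ss : sorted heavier s by apply: sort_sorted => p q; apply: leq_total.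
have us : uniq s by rewrite sort_uniq enum_uniq.
pose tr (p : G * G) := (id p.1, id p.2, wt p).
exists (map tr s); split; last 1 first.
- by move=> _ /mapP [p + ->]; rewrite sP => /PS pa; exists p.1, p.2.
- move=> u b m; split.
    rewrite mem_cat => /orP [/mapP [p]|/mapP [_ /mapP [p + ->]]];
      rewrite sP => /[dup] /PS pa /andP [] + _ [] /id_inj -> -> ->;
      rewrite inE => /andP [_ pe].
      exists p.2; split=> //; rewrite /wt /weight.
      by move: pe; case: (einput _) => k [].
    exists p.1; rewrite adj_sym setUC; split=> //.
    by rewrite /wt /weight; move: pe; case: (einput _) => k [].
  case=> v [uv -> E]; wlog uv' : u v uv E / id u < id v.
    move=> W; case: (ltngtP (id u) (id v)) => [/W ->//|vu|/id_inj Euv].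
      by rewrite symmetrizeC; apply: W => //; rewrite 1?adj_sym 1?setUC.
    by rewrite Euv adj_irr in uv.
  rewrite mem_cat; apply/orP; left; apply/mapP; exists (u, v).
    by rewrite sP /= inE mem_edges uv E uv'.
  by rewrite /tr /wt /weight E.
- rewrite size_map; apply: forest_size (node_gt0 G) _.
  have: {subset s <= P} by move=> p; rewrite sP.
  have htr : transitive heavier by move=> p q r qp pr; apply: leq_trans pr qp.
  move: ss us; rewrite sorted_pairwise //.
  elim: s {sP} => //= -[a b] s IHs /andP [hs ss] /andP [ns us] sub.
  rewrite IHs // ?andbT; last by move=> p ps; apply: sub; rewrite inE ps orbT.
  have Pab : P (a, b) by apply: sub; rewrite mem_head.
  have /andP [sab _] := Pab; rewrite /= kG in sab; last exact: (PS _ Pab).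
  apply: contra sab => /eqP E.
  set e := edge_rel _; suff fE x y : (x, y) \in s -> connect e a x = connect e a y.
    by rewrite -(label_inv fE) -E (label_inv fE) connect0.
  move=> xys; apply: same_connect_r; first exact: connect_edge_sym.
  have Pxy : P (x, y) by apply: sub; rewrite inE xys orbT.
  have /andP [sxy lxy] := Pxy.
  apply: connect1; rewrite /e /edge_rel inE sxy /= ltn_neqAle.
  (* Equal weights would mean the same edge: uniqueness of [s] excludes the same orientation, the
     order of identifiers the opposite one. *)
  rewrite (allP hs _ xys : _ <= _) andbT; apply: contra ns => /eqP/w_inj.
  rewrite !mem_edges => /(_ (PS _ Pxy) (PS _ Pab)) /eq_pair_set.
  case=> [[Ex Ey]|[Ex Ey]]; first by rewrite -Ex -Ey.
  by move: lxy; case/andP: Pab => _; rewrite /= Ex Ey; lia.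
Qed.

End Scheme.

(** * Size of the certificate *)

Lemma ltn_exp_trunc_log n m k K :
  0 < n -> m <= n ^ k -> k <= K -> m < 2 ^ (K * (trunc_log 2 n).+1).+1.
Proof.
move=> n0 mk kK; apply: leq_ltn_trans mk _.
have /andP [_ nL] := trunc_log_bounds (ltnSn 1) n0.
apply: (@leq_ltn_trans (2 ^ (K * (trunc_log 2 n).+1))); last by rewrite ltn_exp2l.
apply: leq_trans (leq_pexp2l n0 kK) _.
by rewrite mulnC expnM; case: K {kK} => // K; rewrite leq_exp2r // ltnW.
Qed.

Theorem theorem4 (kappa c : nat) (hkappa : 1 <= kappa) :
  global_proof_size_in_O kappa (mst_instance c) MST nlogn.
Proof.
(* The exponent [kappa + c] dominates both [kappa] and [c], so [k n] digits suffice for identifiers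
   and weights alike. *)
pose k n := ((kappa + c) * (trunc_log 2 n).+1).+1.
exists 1, mst_verifier, (fun n => n * (3 * (k n).*2.+1)).
have complete (G : mst_graph) (id : G -> nat) :
    mst_instance c G -> valid_ids kappa id -> MST G ->
    exists2 x, all_accept 1 mst_verifier id x &
      size x <= #|G| * (3 * (k #|G|).*2.+1).
  move=> [w_inj w_le] [id_inj id_le] /(MST_kruskal w_inj) kG.
  have [l [Hl sl lP]] := selected_list id_inj w_inj kG.
  have [|x xl sx] := @decode_triples (k #|G|) l.
    move=> _ /lP [u [v [uv ->]]] /=; have n0 := node_gt0 G.
    have /andP [_ wle] := w_le [set u; v] (etrans (mem_edges u v) uv).
    have /andP [_ ule] := id_le u; have /andP [_ vle] := id_le v.
    by split; [apply: ltn_exp_trunc_log ule _|apply: ltn_exp_trunc_log vle _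
              |apply: ltn_exp_trunc_log wle _] => //; rewrite (leq_addr, leq_addl).
  exists x; first by apply/(mst_verifierP id_inj); rewrite xl.
  by apply: leq_trans sx _; rewrite leq_mul2r (ltnW sl) orbT.
split=> //.
  move=> G id iG vid; split=> [[x]|/(complete _ _ iG vid) [x]]; last by exists x.
  case: iG vid => w_inj _ [id_inj _].
  by case/(mst_verifierP id_inj) => _ /(MST_kruskal w_inj).
(* Per entry the bound is [6 * (kappa + c) * (L + 1) + 9] with [L] the logarithm; the threshold 2
   gives [L >= 1], hence [L + 1 <= 2 * L]. *)
exists (12 * (kappa + c) + 9), 2 => n n2; rewrite /nlogn /k.
have L0 : 0 < trunc_log 2 n by rewrite trunc_log_gt0.
rewrite [leqRHS]mulnCA leq_mul2l; apply/orP; right.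
move: (trunc_log 2 n) L0 => L L0; nia.
Qed.
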